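(* Let $f=g\circ F+h$ satisfy Assumption A, let $M-L_g\|L_p\|>0$, and let $(x_k)_{k\ge 0}$ be generated by the RHOTA algorithm. Let $0<r_{\min}\le r_k\le r_{\max}$ and $0\le\delta_k\le\delta_{\max}$ be given, and assume that for every $k\ge 0$ $$\mathcal{M}^{r_k}_{s_M(\cdot;x_k)}(x_{k+1})\le\frac{\delta_k}{(p+1)!}\|x_{k+1}-x_k\|^p .$$ Denote $\bar C=\frac{(p+1)!(f(x_0)-f^* )}{M-L_g\|L_p\|}$ and $$\bar D=\frac{\left(2\bar C^{\frac1{p+1}}+(p+1)r_{\max}\right)L_g\|L_p\|+(p+1)Mr_{\max}+(p+1)\delta_{\max}}{(p+1)!}.$$ Then, for all $k\ge 0$, $$\min_{j=0:k}\mathcal{M}_f^{r_{\min}}(x_{j+1})\le\frac{\bar D\,\big((f(x_0)-f^* )(p+1)!\big)^{\frac p{p+1}}}{(M-L_g\|L_p\|)^{\frac p{p+1}}(k+1)^{\frac p{p+1}}}.$$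
   Context: Problem: $\min_{x\in\mathbb{R}^n} f(x):=g(F(x))+h(x)$, where $F=(F_1,\dots,F_m):\mathbb{R}^n\to\mathbb{R}^m$, and $p\ge 1$ is an integer. Assumption A: (1) each $F_i:\mathbb{R}^n\to\mathbb{R}$ is $p$ times differentiable with $p$th derivative Lipschitz continuous with constant $L_p^i$, i.e. $\|D^pF_i(x)-D^pF_i(y)\|\le L_p^i\|x-y\|$ for all $x,y$; (2) $g:\mathbb{R}^m\to\mathbb{R}$ is convex and Lipschitz continuous with constant $L_g$, and $h:\mathbb{R}^n\to\mathbb{R}\cup\{+\infty\}$ is proper, lower semicontinuous and convex; (3) the problem has a solution, and $f^*$ is a real number with $\inf_{x\in\mathrm{dom} f}f(x)\ge f^*$. Notation: $L_p=(L_p^1,\dots,L_p^m)$, $\|\cdot\|$ is the Euclidean norm; $T_p^{F_i}(y;x)=F_i(x)+\sum_{j=1}^p\frac1{j!}D^jF_i(x)[y-x]^j$, $T_p^F=(T_p^{F_1},\dots,T_p^{F_m})$; $\nabla F(x)$ is the Jacobian and $\nabla T_p^F(y;x)$ is the Jacobian of $T_p^F(\cdot;x)$ at $y$. For $M>0$, $$s_M(y;x):=g\left(T_p^F(y;x)\right)+\frac{M}{(p+1)!}\|y-x\|^{p+1}+h(y).$$ RHOTA algorithm: given $x_0\in\mathrm{dom} f$ and $M>0$, for each $k\ge 0$ take any $x_{k+1}\in\mathrm{dom} f$ with $s_M(x_{k+1};x_k)\le s_M(x_k;x_k)$. Criticality measures, for $r>0$: $$\mathcal{M}_f^r(x):=f(x)-\min_{\|y-x\|\le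 r}\Big(g\big(F(x)+\nabla F(x)(y-x)\big)+h(y)\Big),$$ $$\mathcal{M}^{r}_{s_M(\cdot;x_k)}(x_{k+1}):=g\left(T_p^F(x_{k+1};x_k)\right)+h(x_{k+1})-\min_{\|y-x_{k+1}\|\le r}\Big(g\left(T_p^F(x_{k+1};x_k)+\nabla T_p^F(x_{k+1};x_k)(y-x_{k+1})\right)+\frac{M}{p!}\|x_{k+1}-x_k\|^{p-1}(x_{k+1}-x_k)^T(y-x_{k+1})+h(y)\Big).$$ *)

(* Defs.v *)
From HB Require Import structures.
From mathcomp Require Import all_boot all_order all_algebra.
From mathcomp Require Import all_classical all_reals all_analysis.
Set Implicit Arguments.
Unset Strict Implicit.
Unset Printing Implicit Defensive.
Import Order.TTheory GRing.Theory Num.Theory.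
Import numFieldNormedType.Exports.
Local Open Scope classical_set_scope.
Local Open Scope ring_scope.

(* The library's norm on 'rV[R]_n is the sup norm.  It is used below only
   through the topology (differentials, semicontinuity), which in finite
   dimension does not depend on the norm; every metric quantity uses [enorm]. *)
Definition dotp (R : realType) (n : nat) (u v : 'rV[R]_n) : R :=
  \sum_(i < n) u ord0 i * v ord0 i.

Definition enorm (R : realType) (n : nat) (u : 'rV[R]_n) : R :=
  Num.sqrt (dotp u u).

Definition eclosed_ball (R : realType) (n : nat) (x : 'rV[R]_n) (r : R) :
    set 'rV[R]_n :=
  [set y | enorm (y - x) <= r].

Definition elipschitz (R : realType) (m : nat) (L : R) (g : 'rV[R]_m -> R) :
    Prop :=
  forall u v, `|g u - g v| <= L * enorm (u - v).

(* [iter_diff f [:: v1; ...; vj] x] is D^j f(x)[v1, ..., vj], the Frechet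
   differential being taken first along v1. *)
Fixpoint iter_diff (R : realType) (n : nat) (f : 'rV[R]_n -> R)
    (vs : seq 'rV[R]_n) : 'rV[R]_n -> R :=
  if vs is v :: vs' then iter_diff (fun x => 'd f x v) vs' else f.

Definition nth_diff (R : realType) (n : nat) (j : nat) (f : 'rV[R]_n -> R)
    (x : 'rV[R]_n) : j.-tuple 'rV[R]_n -> R :=
  fun vs => iter_diff f vs x.

(* f is k + 1 times differentiable when it is Frechet differentiable everywhere
   and x |-> Df(x) is k times differentiable.  As R^n is finite-dimensional, the
   latter is expressed on the evaluations x |-> Df(x)[v]. *)
Fixpoint ntimes_differentiable (R : realType) (n : nat) (k : nat)
    (f : 'rV[R]_n -> R) : Prop :=
  if k is k'.+1 then
    (forall x, differentiable f x) /\
    (forall v, ntimes_differentiable k' (fun x => 'd f x v))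
  else True.

(* Taken in \bar R, so that it is +oo on an unbounded form. *)
Definition opnorm (R : realType) (n : nat) (j : nat)
    (A : j.-tuple 'rV[R]_n -> R) : \bar R :=
  ereal_sup [set (`|A vs|)%:E |
    vs in [set vs | forall i, enorm (tnth vs i) <= 1]].

Definition nth_diff_lipschitz (R : realType) (n : nat) (p : nat) (L : R)
    (f : 'rV[R]_n -> R) : Prop :=
  forall x y,
    (opnorm (fun vs : p.-tuple 'rV[R]_n =>
               (nth_diff f x vs - nth_diff f y vs)%R)
     <= (L * enorm (x - y))%:E)%E.

Definition coord_fun (R : realType) (n m : nat) (F : 'rV[R]_n -> 'rV[R]_m)
    (i : 'I_m) : 'rV[R]_n -> R :=
  fun x => F x ord0 i.

(* [taylor p F x y] is T_p^F(y; x). *)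
Definition taylor (R : realType) (n m p : nat) (F : 'rV[R]_n -> 'rV[R]_m)
    (x y : 'rV[R]_n) : 'rV[R]_m :=
  \row_(i < m) (coord_fun F i x +
    \sum_(1 <= j < p.+1)
      (j`!%:R)^-1 * nth_diff (coord_fun F i) x [tuple of nseq j (y - x)]).

Definition edom (R : realType) (n : nat) (f : 'rV[R]_n -> \bar R) :
    set 'rV[R]_n :=
  [set x | (f x < +oo)%E].

Definition eproper (R : realType) (n : nat) (h : 'rV[R]_n -> \bar R) : Prop :=
  (forall x, (-oo < h x)%E) /\ edom h !=set0.

Definition econvex (R : realType) (n : nat) (h : 'rV[R]_n -> \bar R) : Prop :=
  forall (x y : 'rV[R]_n) (t : R), 0 <= t <= 1 ->
    (h (t *: x + (1 - t) *: y)%R <= t%:E * h x + (1 - t)%:E * h y)%E.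

Definition objective (R : realType) (n m : nat) (F : 'rV[R]_n -> 'rV[R]_m)
    (g : 'rV[R]_m -> R) (h : 'rV[R]_n -> \bar R) : 'rV[R]_n -> \bar R :=
  fun x => ((g (F x))%:E + h x)%E.

Record assumptionA (R : realType) (n m p : nat) (F : 'rV[R]_n -> 'rV[R]_m)
    (g : 'rV[R]_m -> R) (h : 'rV[R]_n -> \bar R)
    (Lp : 'rV[R]_m) (Lg fstar : R) : Prop := AssumptionA {
  F_differentiable : forall i, ntimes_differentiable p (coord_fun F i);
  F_lipschitz : forall i, nth_diff_lipschitz p (Lp ord0 i) (coord_fun F i);
  g_convex : convex_function [set: convex_lmodType 'rV[R]_m] g;
  g_lipschitz : elipschitz Lg g;
  h_proper : eproper h;
  h_lsc : lower_semicontinuous h;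
  h_convex : econvex h;
  has_solution :
    exists xs, forall x, (objective F g h xs <= objective F g h x)%E;
  fstar_le_inf :
    (fstar%:E <= ereal_inf (objective F g h @` edom (objective F g h)))%E
}.

(* [model p M F g h x y] is s_M(y; x). *)
Definition model (R : realType) (n m p : nat) (M : R)
    (F : 'rV[R]_n -> 'rV[R]_m) (g : 'rV[R]_m -> R) (h : 'rV[R]_n -> \bar R)
    (x y : 'rV[R]_n) : \bar R :=
  ((g (taylor p F x y) + M / (p.+1)`!%:R * enorm (y - x) ^+ p.+1)%:E + h y)%E.

Definition RHOTA (R : realType) (n m p : nat) (M : R)
    (F : 'rV[R]_n -> 'rV[R]_m) (g : 'rV[R]_m -> R) (h : 'rV[R]_n -> \bar R)
    (x : nat -> 'rV[R]_n) : Prop :=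
  edom (objective F g h) (x 0%N) /\
  forall k, edom (objective F g h) (x k.+1) /\
    (model p M F g h (x k) (x k.+1) <= model p M F g h (x k) (x k))%E.

(* Vectors are rows and the library's 'J acts on the right:
   v *m 'J F x = 'd F x v.  The minimum over the ball is written as an infimum
   in \bar R; it is attained when r >= 0, g is continuous
   and h is proper and lower semicontinuous. *)
Definition criticality (R : realType) (n m : nat)
    (F : 'rV[R]_n -> 'rV[R]_m) (g : 'rV[R]_m -> R) (h : 'rV[R]_n -> \bar R)
    (r : R) (x : 'rV[R]_n) : \bar R :=
  (objective F g h x -
   ereal_inf [set ((g (F x + (y - x) *m 'J F x))%:E + h y)%E |
              y in eclosed_ball x r])%E.

(* M^r_{s_M(.; x)}(x'), with x the current iterate and x' the next one. *)
Definition model_criticality (R : realType) (n m p : nat) (M : R)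
    (F : 'rV[R]_n -> 'rV[R]_m) (g : 'rV[R]_m -> R) (h : 'rV[R]_n -> \bar R)
    (r : R) (x x' : 'rV[R]_n) : \bar R :=
  let T := taylor p F x in
  ((g (T x'))%:E + h x' -
   ereal_inf [set ((g (T x' + (y - x') *m 'J T x')
                    + M / p`!%:R * enorm (x' - x) ^+ p.-1
                      * dotp (x' - x) (y - x'))%:E + h y)%E |
              y in eclosed_ball x' r])%E.

(* Main.v *)
From HB Require Import structures.
Require Import Defs.
From mathcomp Require Import all_boot all_order all_algebra.
From mathcomp Require Import all_classical all_reals all_analysis.
From mathcomp Require Import ring lra.
Set Implicit Arguments.
Unset Strict Implicit.
Unset Printing Implicit Defensive.
Import Order.TTheory GRing.Theory Num.Theory.
Import numFieldNormedType.Exports.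
Local Open Scope classical_set_scope.
Local Open Scope ring_scope.

(** Along a line, comparing derivatives turns the Lipschitz bound on D^p F into
    the Taylor estimates
      ||F(y) - T(y; x)|| <= ||L_p|| ||y - x||^(p+1) / (p+1)!,
      ||(DF(y) - DT(y; x)) v|| <= ||L_p|| ||y - x||^p ||v|| / p!.
    For the second one, symmetry of the second differentials identifies
    DT(y; x) v with the Taylor polynomial of degree p - 1 of DF(.) v.  The first
    estimate makes f decrease by at least
    (M - L_g ||L_p||) ||x_(k+1) - x_k||^(p+1) / (p+1)! per step, so the shortest
    of the first k + 1 steps satisfies ||x_(j+1) - x_j||^(p+1) <= C / (k + 1);
    both estimates together bound the criticality measure of f at x_(j+1) by
    that of the model plus O(||x_(j+1) - x_j||^p). *)

(** * Iterated differentials: linearity and homogeneity *)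

Lemma is_diff_sum (R : numFieldType) (V W : normedModType R) (n : nat)
    (f df : 'I_n -> V -> W) (x : V) :
  (forall i, is_diff x (f i) (df i)) ->
  is_diff x (fun y => \sum_(i < n) f i y) (fun v => \sum_(i < n) df i v).
Proof.
move=> fdf.
have -> : (fun y => \sum_(i < n) f i y) = \sum_(i < n) f i.
  by apply/funext => y; rewrite fct_sumE.
have -> : (fun y => \sum_(i < n) df i y) = \sum_(i < n) df i.
  by apply/funext => y; rewrite fct_sumE.
by elim/big_ind2 : _ => // [|f1 df1 f2 df2 h1 h2]; [exact: is_diff_cst | exact: is_diffD].
Qed.

Lemma ntimes_differentiableW (R : realType) (n k l : nat) (f : 'rV[R]_n -> R) :
  (l <= k)%N -> ntimes_differentiable k f -> ntimes_differentiable l f.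
Proof.
elim: k l f => [|k IHk] [|l] f //= lk [df ddf]; split => // v.
exact: IHk (ddf v).
Qed.

Lemma iter_diff_lincomb (R : realType) (n m : nat) (c : 'I_m -> R)
    (f : 'I_m -> 'rV[R]_n -> R) (vs : seq 'rV[R]_n) :
  (forall i, ntimes_differentiable (size vs) (f i)) ->
  iter_diff (fun x => \sum_(i < m) c i * f i x) vs =
  (fun x => \sum_(i < m) c i * iter_diff (f i) vs x).
Proof.
elim: vs f => [//|v vs IHvs] f ntf /=.
rewrite -(IHvs (fun i x => 'd (f i) x v)); last by move=> i; case: (ntf i) => _; exact.
congr (iter_diff _ vs); apply/funext => x.
have /(@diff_val _ _ _ _ _ _ _) -> // :
    is_diff x (fun x => \sum_(i < m) c i * f i x)
      (fun v => \sum_(i < m) c i * 'd (f i) x v).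
apply: is_diff_sum => i; apply: is_diffZ; apply: differentiableP.
by case: (ntf i).
Qed.

Lemma iter_diffZ (R : realType) (n : nat) (c : R)
    (f : 'rV[R]_n -> R) (vs : seq 'rV[R]_n) :
  ntimes_differentiable (size vs) f ->
  iter_diff (fun x => c * f x) vs = (fun x => c * iter_diff f vs x).
Proof.
move=> ntf; have := @iter_diff_lincomb R n 1 (fun=> c) (fun=> f) vs (fun=> ntf).
rewrite (_ : (fun _ => _) = fun x => c * f x); last by apply/funext => x; rewrite big_ord1.
by move=> ->; apply/funext => x; rewrite big_ord1.
Qed.

Lemma iter_diff_scale (R : realType) (n : nat) (T : Type) (a : T -> R)
    (b : T -> 'rV[R]_n) (f : 'rV[R]_n -> R) (s : seq T) (x : 'rV[R]_n) :
  ntimes_differentiable (size s) f ->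
  iter_diff f [seq a i *: b i | i <- s] x =
  (\prod_(i <- s) a i) * iter_diff f [seq b i | i <- s] x.
Proof.
elim: s f => [|i s IHs] f /=; first by rewrite big_nil mul1r.
move=> [df ddf]; rewrite big_cons.
have -> : (fun y => 'd f y (a i *: b i)) = (fun y => a i * 'd f y (b i)).
  by apply/funext => y; rewrite linearZ.
rewrite iter_diffZ; last by rewrite size_map; exact: ddf.
by rewrite IHs// mulrA.
Qed.

(** * Taylor estimates along a line *)

Lemma is_derive_line (R : realType) (n : nat) (f : 'rV[R]_n -> R)
    (x d : 'rV[R]_n) (t : R) :
  differentiable f (x + t *: d) ->
  is_derive t 1 (fun s => f (x + s *: d)) ('d f (x + t *: d) d).
Proof.
move=> df.
have h1 : is_diff t (cst x + *:%R ^~ d) (0 + *:%R ^~ d : R -> 'rV[R]_n).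
  by apply: is_diffD.
have h2 : is_diff t (f \o (cst x + *:%R ^~ d))
    ('d f (x + t *: d) \o (0 + *:%R ^~ d : R -> 'rV[R]_n)).
  by apply: is_diff_comp; exact: differentiableP.
have [h3 h4] := h2.
apply: DeriveDef; first exact: diff_derivable.
by rewrite deriveE// h4 /= /GRing.add /= add0r scale1r.
Qed.

Lemma is_derive_monomial (R : realType) (k : nat) (c t : R) :
  is_derive t 1 (fun s => c * s ^+ k) (c * (k%:R * t ^+ k.-1)).
Proof.
apply: (@is_deriveZ R R R (fun s => s ^+ k) c t 1 (k%:R * t ^+ k.-1)).
apply: DeriveDef; first exact: exprn_derivable.
by rewrite exp_derive /GRing.scale /= mulr1.
Qed.

(** [K * t^(p+1) / (p+1)!] is the primitive, vanishing at 0, of the bound on [dphi], so its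
    difference with [phi] is nondecreasing on [t >= 0]; the same for [- phi] gives the absolute
    value. *)
Lemma growth_comparison (R : realType) (p : nat) (K : R) (phi dphi : R -> R) :
  (forall t : R, is_derive t 1 phi (dphi t)) -> phi 0 = 0 ->
  (forall t : R, 0 <= t -> `|dphi t| <= K * t ^+ p / p`!%:R) ->
  forall t : R, 0 <= t -> `|phi t| <= K * t ^+ p.+1 / p.+1`!%:R.
Proof.
move=> dphiP phi0 bound.
have one_sided (psi dpsi : R -> R) : (forall t : R, is_derive t 1 psi (dpsi t)) ->
    psi 0 = 0 -> (forall t : R, 0 <= t -> `|dpsi t| <= K * t ^+ p / p`!%:R) ->
    forall t : R, 0 <= t -> psi t <= K * t ^+ p.+1 / p.+1`!%:R.
  move=> dpsiP psi0 {}bound t t0; rewrite -subr_ge0.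
  pose chi (s : R) := (K / p.+1`!%:R) * s ^+ p.+1 - psi s.
  have dchi (s : R) : is_derive s 1 chi (K * s ^+ p / p`!%:R - dpsi s).
    rewrite /chi.
    have h := is_deriveB (is_derive_monomial p.+1 (K / p.+1`!%:R) s) (dpsiP s).
    apply: (is_derive_eq h).
    congr (_ - _); rewrite /= factS natrM.
    have p0 : (p`!%:R : R) != 0 by rewrite pnatr_eq0 -lt0n fact_gt0.
    have p1 : (p.+1%:R : R) != 0 by rewrite pnatr_eq0.
    by field; rewrite p0 addrC natr1 p1.
  have chi0 : chi 0 = 0 by rewrite /chi expr0n /= mulr0 psi0 subr0.
  suff : chi 0 <= chi t by rewrite chi0 /chi -[X in _ <= X - _](mulrAC _ _ _).
  apply: (@ger0_derive1_ndecry R chi 0) => //.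
  - move=> s; rewrite in_itv /= andbT => s0; rewrite derive1E derive_val subr_ge0.
    by apply: le_trans (ler_norm _) _; apply: bound; exact: ltW.
  - apply: continuous_subspaceT => s; apply: differentiable_continuous.
    by apply/derivable1_diffP.
move=> t t0; rewrite ler_norml; apply/andP; split; last exact: one_sided bound t t0.
rewrite lerNl; apply: (one_sided (fun s => - phi s) (fun s => - dphi s)) => //.
- by rewrite phi0 oppr0.
- by move=> s s0; rewrite normrN; exact: bound.
Qed.

(** Induction on [p], the case [p = 0] being the hypothesis itself. Otherwise the derivative in [t]
    of the remainder of [f] is the remainder of order [p - 1] of [Df(.) d], and [growth_comparison]
    integrates its bound. *)
Lemma taylor_line (R : realType) (n p : nat) (f : 'rV[R]_n -> R)
    (x d : 'rV[R]_n) (K : R) :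
  ntimes_differentiable p f ->
  (forall t : R, 0 <= t -> `|iter_diff f (nseq p d) (x + t *: d)
                         - iter_diff f (nseq p d) x| <= K * t) ->
  forall t : R, 0 <= t ->
    `|f (x + t *: d) - \sum_(j < p.+1) t ^+ j / j`!%:R * iter_diff f (nseq j d) x|
    <= K * t ^+ p.+1 / p.+1`!%:R.
Proof.
elim: p f => [|p IHp] f /=.
  move=> _ bound t t0; rewrite big_ord1 /= expr0 !divr1 mul1r.
  by rewrite expr1; exact: bound.
move=> [df ddf] bound.
pose a j := iter_diff f (nseq j d) x.
apply: (@growth_comparison R p.+1 K _
  (fun t => 'd f (x + t *: d) d - \sum_(j < p.+1) t ^+ j / j`!%:R * a j.+1)).
- move=> t; apply: is_deriveB; first exact: is_derive_line.
  have -> : (fun t => \sum_(j < p.+2) t ^+ j / j`!%:R * a j) =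
      \sum_(j < p.+2) (fun t : R => (a j / j`!%:R) * t ^+ j).
    apply/funext => s; rewrite fct_sumE; apply: eq_bigr => j _ /=.
    by rewrite -mulrA mulrC [_^-1 * _]mulrC.
  pose da (j : 'I_p.+2) := (a j / j`!%:R) * (j%:R * t ^+ j.-1).
  (* The constant term has derivative 0, so the differentiated sum loses its first term and its
     indices shift by one. *)
  have -> : \sum_(j < p.+1) t ^+ j / j`!%:R * a j.+1 = \sum_(j < p.+2) da j.
    rewrite [RHS]big_ord_recl {1}/da /= mul0r mulr0 add0r.
    apply: eq_bigr => j _; rewrite /da /= /bump /= add1n.
    have p0 : (j`!%:R : R) != 0 by rewrite pnatr_eq0 -lt0n fact_gt0.
    have p1 : (j.+1%:R : R) != 0 by rewrite pnatr_eq0.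
    rewrite factS natrM; field.
    by rewrite p0 addrC natr1 p1.
  apply: is_derive_sum => j; exact: is_derive_monomial.
- rewrite scale0r addr0 big_ord_recl /= expr0 divr1 mul1r big1 ?addr0 ?subrr//.
  by move=> j _; rewrite /bump /= exprS !mul0r.
- move=> t t0; exact: (IHp (fun y => 'd f y d) (ddf d)).
Qed.

(** * Symmetry of second differentials *)

(** The mean value theorem for [s |-> f (x + t v + s u) - f (x + s u)] on [[0, t]] turns the second
    difference into [t] times an increment of [g = Df(.) u]; expanding both values of [g] at [x]
    leaves [t^2 * Dg(x) v] up to [o(t^2)]. *)
Lemma second_difference (R : realType) (n : nat) (f : 'rV[R]_n -> R)
    (x u v : 'rV[R]_n) (e : R) :
  (forall y, differentiable f y) -> differentiable (fun y => 'd f y u) x ->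
  0 < e ->
  \forall t \near 0^'+, `|f (x + t *: u + t *: v) - f (x + t *: u)
    - f (x + t *: v) + f x - t ^+ 2 * 'd (fun y => 'd f y u) x v| <= e * t ^+ 2.
Proof.
move=> df ddf e0.
set g := fun y => 'd f y u.
(* The increments [t v + s u] and [s u], with [0 < s < t], have norms adding up to at most [t * B];
   the summand 1 makes [B] positive. *)
pose B := `|u| + `|v| + `|u| + 1.
have B0 : 0 < B by rewrite /B ltr_wpDl// !addr_ge0.
have /eqaddoP/(_ (e / B)) := diff_locally ddf.
rewrite divr_gt0// => /(_ isT) /nbhs_ballP[r /= r0 hr].
have {}hr w : `|w| < r -> `|g (x + w) - g x - 'd g x w| <= e / B * `|w|.
  move=> wr; have /hr : ball 0 r w by rewrite -ball_normE /ball_ /= sub0r normrN.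
  rewrite /= => hw.
  have -> : g (x + w) - g x - 'd g x w = g (w + x) - (g x + 'd g x w).
    by rewrite (addrC x w) opprD addrA.
  exact: hw.
near=> t.
have t0 : 0 < t by near: t; exact: nbhs_right_gt.
have tr : t * B < r.
  rewrite -ltr_pdivlMr//; near: t; apply: nbhs_right_lt; exact: divr_gt0.
pose psi s := f (x + t *: v + s *: u) - f (x + s *: u).
pose dpsi s := g (x + t *: v + s *: u) - g (x + s *: u).
have dpsiP (s : R) : is_derive s 1 psi (dpsi s).
  by apply: is_deriveB; exact: is_derive_line.
have [|s] := @MVT R psi dpsi 0 t t0 (fun s _ => dpsiP s).
  apply: continuous_subspaceT => s; apply: differentiable_continuous.
  by apply/derivable1_diffP.
rewrite in_itv /= => /andP[s0 st].
rewrite /psi scale0r !addr0 subr0 => psiE.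
have -> : f (x + t *: u + t *: v) - f (x + t *: u) - f (x + t *: v) + f x
    = dpsi s * t.
  by rewrite -psiE [x + t *: u + _]addrAC; ring.
have n1 : `|t *: v + s *: u| <= t * (`|u| + `|v|).
  rewrite (le_trans (ler_normD _ _))// !normrZ !gtr0_norm// mulrDr addrC lerD2r.
  by rewrite ler_wpM2r// ltW.
have n2 : `|s *: u| <= t * `|u| by rewrite normrZ gtr0_norm// ler_wpM2r// ltW.
have /hr h1 : `|t *: v + s *: u| < r.
  apply: le_lt_trans n1 _; apply: le_lt_trans tr; rewrite ler_pM2l//.
  by rewrite /B -addrA lerDl addr_ge0.
have /hr h2 : `|s *: u| < r.
  apply: le_lt_trans n2 _; apply: le_lt_trans tr; rewrite ler_pM2l//.
  by rewrite /B -!addrA lerDl !addr_ge0.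
(* By linearity the terms [Dg(x)(s u)] cancel. Only two first-order remainders of [g] are left, each
   at most [e / B] times the norm of its increment. *)
have -> : dpsi s * t - t ^+ 2 * 'd g x v = t * (
    (g (x + (t *: v + s *: u)) - g x - 'd g x (t *: v + s *: u))
    - (g (x + s *: u) - g x - 'd g x (s *: u))).
  have -> : 'd g x (t *: v + s *: u) = t * 'd g x v + s * 'd g x u.
    by rewrite linearD !linearZ.
  have -> : 'd g x (s *: u) = s * 'd g x u by rewrite linearZ.
  rewrite /dpsi addrA.
  move: ('d g x v) ('d g x u) (g _) (g (x + _)) (g x) => a b c d k; ring.
rewrite normrM gtr0_norm// expr2 mulrCA ler_pM2l//.
apply: le_trans (ler_normB _ _) _; apply: le_trans (lerD h1 h2) _.
rewrite -mulrDr -mulrA ler_pM2l// mulrC ler_pdivrMr//.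
apply: le_trans (lerD n1 n2) _.
by rewrite -mulrDr ler_pM2l// /B lerDl.
Unshelve. all: by end_near. Qed.

(* Both sides are the limit of the same second difference quotient of [f],
   which is symmetric in [u] and [v]. *)
Lemma diff_diffC (R : realType) (n : nat) (f : 'rV[R]_n -> R) (x u v : 'rV[R]_n) :
  (forall y, differentiable f y) -> differentiable (fun y => 'd f y u) x ->
  differentiable (fun y => 'd f y v) x ->
  'd (fun y => 'd f y u) x v = 'd (fun y => 'd f y v) x u.
Proof.
move=> df ddu ddv; pose B := 'd (fun y => 'd f y u) x v.
pose A := 'd (fun y => 'd f y v) x u.
suff : B = A by [].
apply/eqP; rewrite -subr_eq0 -normr_le0.
apply/ler_addgt0Pl => e e0; rewrite addr0.
have e2 : 0 < e / 2 by rewrite divr_gt0.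
near (0 : R)^'+ => t.
have t0 : 0 < t by near: t; exact: nbhs_right_gt.
have t20 : 0 < t ^+ 2 by rewrite exprn_gt0.
have h1 : `|f (x + t *: u + t *: v) - f (x + t *: u) - f (x + t *: v) + f x
    - t ^+ 2 * B| <= e / 2 * t ^+ 2.
  by near: t; exact: second_difference.
have h2 : `|f (x + t *: v + t *: u) - f (x + t *: v) - f (x + t *: u) + f x
    - t ^+ 2 * A| <= e / 2 * t ^+ 2.
  by near: t; exact: second_difference.
rewrite -(ler_pM2l t20) -[X in X * _ <= _]gtr0_norm// -normrM.
rewrite [x + t *: v + _]addrAC in h2; set D := f _ in h1 h2; move: h1 h2.
move: (f (x + t *: u)) (f (x + t *: v)) (f x) => b c d h1 h2.
have -> : t ^+ 2 * (B - A) =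
  (D - c - b + d - t ^+ 2 * A) -
  (D - b - c + d - t ^+ 2 * B) by ring.
apply: le_trans (ler_normB _ _) _; apply: le_trans (lerD h2 h1) _.
by rewrite -mulrDl -splitr mulrC.
Unshelve. all: by end_near. Qed.

(** * Differential of the forms [w |-> D^j f(x)[w, ..., w]] *)

Lemma diff_basisE (R : realType) (n : nat) (f : 'rV[R]_n -> R) (x v : 'rV[R]_n) :
  'd f x v = \sum_(i < n) v ord0 i * 'd f x (delta_mx 0 i).
Proof.
rewrite [in LHS](row_sum_delta v) linear_sum; apply: eq_bigr => i _.
by rewrite linearZ.
Qed.

(** Expanding the first direction in the canonical basis turns it into scalar factors, so that the
    dependence on [w] can be differentiated by the product rule. *)
Lemma iter_diff_consE (R : realType) (n : nat) (f : 'rV[R]_n -> R) (w : 'rV[R]_n)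
    (vs : seq 'rV[R]_n) (x : 'rV[R]_n) :
  ntimes_differentiable (size vs).+1 f ->
  iter_diff f (w :: vs) x =
  \sum_(i < n) w ord0 i * iter_diff (fun y => 'd f y (delta_mx 0 i)) vs x.
Proof.
move=> [df ddf] /=.
rewrite (_ : (fun y => 'd f y w) = fun y => \sum_(i < n) w ord0 i * 'd f y (delta_mx 0 i)).
  by rewrite iter_diff_lincomb// => i; exact: ddf.
by apply/funext => y; exact: diff_basisE.
Qed.

(** Induction on the degree. In degree [j + 1], the product rule gives one term with [v] in the
    first slot and, by induction, [j] times the term with [v] in the second slot; [diff_diffC]
    exchanges the first two slots. *)
Lemma is_diff_iter_diff_nseq (R : realType) (n j : nat) (f : 'rV[R]_n -> R)
    (x w : 'rV[R]_n) :
  ntimes_differentiable j f ->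
  is_diff w (fun w => iter_diff f (nseq j w) x)
    (fun v => j%:R * iter_diff f (v :: nseq j.-1 w) x).
Proof.
elim: j f w => [|j IHj] f w ntf.
  apply: (@is_diff_eq _ _ _ _ 0); first exact: is_diff_cst.
  by apply/funext => v; rewrite mul0r.
have [df ddf] := ntf.
pose e_ i : 'rV[R]_n := delta_mx 0 i.
pose fi i y := 'd f y (e_ i).
have -> : (fun w => iter_diff f (nseq j.+1 w) x) =
    (fun w : 'rV[R]_n => \sum_(i < n) w ord0 i * iter_diff (fi i) (nseq j w) x).
  by apply/funext => z; rewrite iter_diff_consE ?size_nseq.
have dterm i : is_diff w (fun w : 'rV[R]_n => w ord0 i * iter_diff (fi i) (nseq j w) x)
    (fun v => w ord0 i * (j%:R * iter_diff (fi i) (v :: nseq j.-1 w) x)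
              + iter_diff (fi i) (nseq j w) x * v ord0 i).
  have c : is_diff w (fun z : 'rV[R]_n => z ord0 i) (fun z => z ord0 i).
    have l : linear (fun z : 'rV[R]_n => z ord0 i : R) by move=> a y z; rewrite !mxE.
    pose lL : {linear 'rV[R]_n -> R} := HB.pack (fun z : 'rV[R]_n => z ord0 i : R)
      (GRing.isLinear.Build _ _ _ _ _ l).
    apply: DiffDef; first exact: differentiable_coord.
    apply: (@diff_lin _ _ _ lL) => z; exact: coord_continuous.
  exact: (is_diffM c (IHj (fi i) w (ddf _))).
apply: is_diff_eq (is_diff_sum dterm) _; apply/funext => v.
rewrite big_split /=.
have -> : \sum_(i < n) iter_diff (fi i) (nseq j w) x * v ord0 i =
    iter_diff f (v :: nseq j w) x.
  by rewrite iter_diff_consE ?size_nseq//; apply: eq_bigr => i _; rewrite mulrC.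
rewrite -natr1 mulrDl mul1r; congr (_ + _).
(* For [j = 0] the value of [j.-1] is a mere default: the factor [j] makes both sides vanish. *)
case: j {IHj dterm} ntf ddf => [|j] ntf ddf.
  by rewrite mul0r big1// => i _; rewrite mul0r mulr0.
have ddv := ddf v.
have := @iter_diff_consE R n (fun y => 'd f y v) w (nseq j w) x.
rewrite size_nseq => /(_ ddv) /= ->; rewrite mulr_sumr; apply: eq_bigr => i _.
rewrite mulrCA; congr (_ * (_ * iter_diff _ _ _)); apply/funext => y.
by apply: diff_diffC => //; [case: (ddf (e_ i))|case: ddv].
Qed.

(** * Jacobians by coordinates *)

Lemma is_diff_row (R : realType) (V : normedModType R) (m : nat)
    (F : V -> 'rV[R]_m) (df : 'I_m -> V -> R) (x : V) :
  (forall i, is_diff x (fun y => F y ord0 i) (df i)) ->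
  is_diff x F (fun v => \row_i df i v).
Proof.
move=> dF.
have -> : F = fun y => \sum_(i < m) F y ord0 i *: delta_mx 0 i.
  by apply/funext => y; rewrite -row_sum_delta.
have -> : (fun v => \row_i df i v) = fun v => \sum_(i < m) df i v *: delta_mx 0 i.
  apply/funext => v; rewrite [LHS]row_sum_delta.
  by apply: eq_bigr => i _; rewrite mxE.
apply: is_diff_sum => i; have [dFi dFiE] := dF i.
apply: DiffDef; first exact: differentiableZl.
by rewrite diffZl// dFiE.
Qed.

Lemma jacobian_coord (R : realType) (n m : nat) (F : 'rV[R]_n -> 'rV[R]_m)
    (x v : 'rV[R]_n) (i : 'I_m) :
  (forall i, differentiable (coord_fun F i) x) ->
  (v *m 'J F x) ord0 i = 'd (coord_fun F i) x v.
Proof.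
move=> dF; have /(@diff_val _ _ _ _ _ _ _) dFE :=
  is_diff_row (fun i => differentiableP (dF i)).
by rewrite /jacobian mul_rV_lin1 dFE mxE.
Qed.

(** * The Euclidean norm *)

Lemma dotp_ge0 (R : realType) (n : nat) (u : 'rV[R]_n) : 0 <= dotp u u.
Proof. by apply: sumr_ge0 => i _; rewrite -expr2 sqr_ge0. Qed.

Lemma enorm_ge0 (R : realType) (n : nat) (u : 'rV[R]_n) : 0 <= enorm u.
Proof. exact: sqrtr_ge0. Qed.

Lemma sqr_enorm (R : realType) (n : nat) (u : 'rV[R]_n) : enorm u ^+ 2 = dotp u u.
Proof. by rewrite sqr_sqrtr// dotp_ge0. Qed.

Lemma enorm_eq0 (R : realType) (n : nat) (u : 'rV[R]_n) : enorm u = 0 -> u = 0.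
Proof.
move=> u0; have /eqP : dotp u u = 0 by rewrite -sqr_enorm u0 expr0n.
rewrite psumr_eq0; last by move=> i _; rewrite -expr2 sqr_ge0.
move=> /allP u00; apply/rowP => i; rewrite mxE; apply/eqP.
by have := u00 i (mem_index_enum i); rewrite -expr2 sqrf_eq0.
Qed.

Lemma dotpZ (R : realType) (n : nat) (a : R) (u v : 'rV[R]_n) :
  dotp (a *: u) (a *: v) = a ^+ 2 * dotp u v.
Proof.
rewrite mulr_sumr; apply: eq_bigr => i _; rewrite !mxE; ring.
Qed.

Lemma enormZ (R : realType) (n : nat) (a : R) (u : 'rV[R]_n) :
  enorm (a *: u) = `|a| * enorm u.
Proof. by rewrite /enorm dotpZ sqrtrM ?sqr_ge0// sqrtr_sqr. Qed.

Lemma dotp_cauchy_schwarz (R : realType) (n : nat) (u v : 'rV[R]_n) :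
  `|dotp u v| <= enorm u * enorm v.
Proof.
have [/enorm_eq0 ->|v0] := eqVneq (enorm v) 0.
  have -> : dotp u 0 = 0 by rewrite /dotp big1// => i _; rewrite mxE mulr0.
  by rewrite normr0 mulr_ge0// enorm_ge0.
have b0 : 0 < dotp v v by rewrite -sqr_enorm exprn_even_gt0.
rewrite -(@ler_pXn2r _ 2)// ?nnegrE ?mulr_ge0 ?enorm_ge0//.
rewrite real_normK ?num_real// exprMn !sqr_enorm -subr_ge0 -(pmulr_rge0 _ b0).
(* The defect in Cauchy-Schwarz, scaled by [dotp v v], is the squared norm of a multiple of the
   component of [u] orthogonal to [v]. *)
have -> : dotp v v * (dotp u u * dotp v v - dotp u v ^+ 2) =
    dotp (dotp v v *: u - dotp u v *: v) (dotp v v *: u - dotp u v *: v).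
  have expand (a c : R) : dotp (a *: u - c *: v) (a *: u - c *: v) =
      a ^+ 2 * dotp u u - 2 * a * c * dotp u v + c ^+ 2 * dotp v v.
    rewrite /dotp !mulr_sumr -sumrB -big_split /=; apply: eq_bigr => i _.
    rewrite !mxE; ring.
  rewrite expand; ring.
exact: dotp_ge0.
Qed.

(** Squares of the coordinate bounds are summed; with [L = Lp], this is where the norm of the vector
    of Lipschitz constants comes from. *)
Lemma enorm_le_coord (R : realType) (m : nat) (c : R) (u L : 'rV[R]_m) :
  0 <= c -> (forall i, `|u ord0 i| <= c * L ord0 i) -> enorm u <= c * enorm L.
Proof.
move=> c0 uL; rewrite -[c in leRHS]ger0_norm// -enormZ /enorm ler_wsqrtr//.
apply: ler_sum => i _; rewrite -!expr2 -real_normK ?num_real// mxE.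
by rewrite ler_pXn2r// nnegrE// (le_trans _ (uL i)).
Qed.

(** * Taylor remainders in the Euclidean norm *)

(** The operator norm sees only directions in the unit ball; homogeneity in each slot extends its
    bound to all directions. *)
Lemma iter_diff_lipschitz (R : realType) (n p : nat) (L : R)
    (f : 'rV[R]_n -> R) (vs : seq 'rV[R]_n) (x z : 'rV[R]_n) :
  ntimes_differentiable p f -> nth_diff_lipschitz p L f -> size vs = p ->
  `|iter_diff f vs z - iter_diff f vs x| <= L * enorm (z - x) * \prod_(v <- vs) enorm v.
Proof.
move=> df Lf svs.
(* For [v = 0] the convention [0^-1 = 0] gives [b v = 0], still of norm at most 1. *)
pose b (v : 'rV[R]_n) := (enorm v)^-1 *: v.
have vsE : vs = [seq enorm v *: b v | v <- vs].
  rewrite -[LHS]map_id; apply: eq_map => v.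
  have [v0|v0] := eqVneq (enorm v) 0; first by rewrite v0 scale0r (enorm_eq0 v0).
  by rewrite scalerA divff// scale1r.
rewrite {1 2}vsE !(@iter_diff_scale _ _ _ (@enorm R n) b) ?svs// -mulrBr normrM mulrC.
have prod0 : 0 <= \prod_(v <- vs) enorm v.
  by apply: prodr_ge0 => v _; exact: enorm_ge0.
rewrite (ger0_norm prod0) ler_wpM2r//.
have sb : size [seq b v | v <- vs] == p by rewrite size_map svs.
rewrite -lee_fin; apply: le_trans (Lf z x).
apply: ereal_sup_ubound; exists (Tuple sb) => //= i.
rewrite (tnth_nth 0) /= (nth_map 0) ?svs// enormZ ger0_norm ?invr_ge0 ?enorm_ge0//.
by have [->|v0] := eqVneq (enorm vs`_i) 0; [rewrite mulr0|rewrite mulVf].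
Qed.

Lemma prodr_nseq (R : realType) (T : Type) (k : nat) (w : T) (a : T -> R) :
  \prod_(v <- nseq k w) a v = a w ^+ k.
Proof. by rewrite big_nseq -Monoid.iteropE. Qed.

Lemma taylor_coordE (R : realType) (n m p : nat) (F : 'rV[R]_n -> 'rV[R]_m)
    (x y : 'rV[R]_n) (i : 'I_m) :
  taylor p F x y ord0 i =
  \sum_(j < p.+1) (j`!%:R)^-1 * iter_diff (coord_fun F i) (nseq j (y - x)) x.
Proof.
by rewrite mxE -(big_mkord xpredT (fun j => (j`!%:R)^-1 * iter_diff (coord_fun F i)
  (nseq j (y - x)) x)) big_nat_recl//= invr1 mul1r big_add1.
Qed.

(** This is [taylor_line] at [t = 1] in the direction [y - x]. The factor [L] comes last so that
    [enorm_le_coord] can gather the coordinates. *)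
Lemma taylor_remainder_coord (R : realType) (n p : nat) (L : R)
    (f : 'rV[R]_n -> R) (x y : 'rV[R]_n) :
  ntimes_differentiable p f -> nth_diff_lipschitz p L f ->
  `|f y - \sum_(j < p.+1) (j`!%:R)^-1 * iter_diff f (nseq j (y - x)) x|
  <= enorm (y - x) ^+ p.+1 / p.+1`!%:R * L.
Proof.
move=> df Lf; set d := y - x.
have lip (t : R) : 0 <= t -> `|iter_diff f (nseq p d) (x + t *: d)
    - iter_diff f (nseq p d) x| <= L * enorm d ^+ p.+1 * t.
  move=> t0; apply: le_trans (iter_diff_lipschitz _ _ df Lf (size_nseq _ _)) _.
  rewrite prodr_nseq [x + _]addrC addrK enormZ ger0_norm//.
  by rewrite [leLHS](_ : _ = L * enorm d ^+ p.+1 * t)// exprS; ring.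
have := taylor_line df lip ler01.
rewrite scale1r /d [x + _]addrC subrK expr1n mulr1 -mulrA mulrC.
by under eq_bigr do rewrite expr1n mul1r.
Qed.

(** The form of degree [j] yields a factor [j], which turns [1/j!] into [1/(j-1)!]; the index then
    shifts by one. *)
Lemma is_diff_taylor_coord (R : realType) (n p : nat)
    (f : 'rV[R]_n -> R) (x y : 'rV[R]_n) :
  ntimes_differentiable p f ->
  is_diff y (fun y => \sum_(j < p.+1) (j`!%:R)^-1 * iter_diff f (nseq j (y - x)) x)
   (fun v => \sum_(j < p) (j`!%:R)^-1 * iter_diff f (v :: nseq j (y - x)) x).
Proof.
move=> df.
have dshift : is_diff y (fun z => z - x) id.
  by apply: is_diff_eq (is_diffB (is_diff_id y) (is_diff_cst x y)) _; rewrite subr0.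
have dterm (j : 'I_p.+1) :
    is_diff y (fun y => (j`!%:R)^-1 * iter_diff f (nseq j (y - x)) x)
      (fun v => (j`!%:R)^-1 * (j%:R * iter_diff f (v :: nseq j.-1 (y - x)) x)).
  have dfj := ntimes_differentiableW (leq_ord j) df.
  exact: (is_diffZ _ (is_diff_comp dshift (is_diff_iter_diff_nseq x (y - x) dfj))).
apply: is_diff_eq (is_diff_sum dterm) _; apply/funext => v.
rewrite big_ord_recl /= mul0r mulr0 add0r; apply: eq_bigr => j _.
rewrite /bump /= add1n mulrA; congr (_ * _).
have p1 : (j.+1%:R : R) != 0 by rewrite pnatr_eq0.
by rewrite factS natrM invfM mulrAC mulVf// mul1r.
Qed.

(** The line argument is repeated for [Df(.) v], whose differential of order [p] is [D^(p+1) f] with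
    [v] in the first slot; that slot contributes the factor [enorm v]. *)
Lemma taylor_diff_remainder_coord (R : realType) (n p : nat) (L : R)
    (f : 'rV[R]_n -> R) (x y v : 'rV[R]_n) :
  ntimes_differentiable p.+1 f -> nth_diff_lipschitz p.+1 L f ->
  `|'d f y v - \sum_(j < p.+1) (j`!%:R)^-1 * iter_diff f (v :: nseq j (y - x)) x|
  <= enorm (y - x) ^+ p.+1 / p.+1`!%:R * enorm v * L.
Proof.
move=> df Lf; set d := y - x; pose g z := 'd f z v.
have lip (t : R) : 0 <= t -> `|iter_diff g (nseq p d) (x + t *: d)
    - iter_diff g (nseq p d) x| <= L * enorm v * enorm d ^+ p.+1 * t.
  move=> t0; have sz : size (v :: nseq p d) = p.+1 by rewrite /= size_nseq.
  apply: le_trans (iter_diff_lipschitz x (x + t *: d) df Lf sz) _.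
  rewrite big_cons prodr_nseq [x + _]addrC addrK enormZ ger0_norm//.
  by rewrite [leLHS](_ : _ = L * enorm v * enorm d ^+ p.+1 * t)// exprS; ring.
have := taylor_line (df.2 v) lip ler01.
rewrite scale1r /d [x + _]addrC subrK expr1n mulr1.
rewrite -mulrA mulrC [L * _]mulrC mulrA.
by under eq_bigr do rewrite expr1n mul1r.
Qed.

Lemma enorm_taylor_remainder (R : realType) (n m p : nat)
    (F : 'rV[R]_n -> 'rV[R]_m) (L : 'rV[R]_m) (x y : 'rV[R]_n) :
  (forall i, ntimes_differentiable p (coord_fun F i)) ->
  (forall i, nth_diff_lipschitz p (L ord0 i) (coord_fun F i)) ->
  enorm (F y - taylor p F x y) <= enorm (y - x) ^+ p.+1 / p.+1`!%:R * enorm L.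
Proof.
move=> dF LF; apply: enorm_le_coord => [|i].
  by rewrite divr_ge0// exprn_ge0// enorm_ge0.
rewrite mxE [X in _ + X]mxE taylor_coordE; exact: taylor_remainder_coord.
Qed.

(** Compares the arguments of [g] in the two criticality measures. Each coordinate of the difference
    splits into the remainder of the value at [y] and that of the differential along [v]. *)
Lemma enorm_taylor_linearization (R : realType) (n m p : nat)
    (F : 'rV[R]_n -> 'rV[R]_m) (L : 'rV[R]_m) (x y v : 'rV[R]_n) :
  (0 < p)%N ->
  (forall i, ntimes_differentiable p (coord_fun F i)) ->
  (forall i, nth_diff_lipschitz p (L ord0 i) (coord_fun F i)) ->
  enorm ((F y + v *m 'J F y) - (taylor p F x y + v *m 'J (taylor p F x) y))
  <= (enorm (y - x) ^+ p.+1 / p.+1`!%:R + enorm (y - x) ^+ p / p`!%:R * enorm v) * enorm L.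
Proof.
case: p => [//|p] _ dF LF; apply: enorm_le_coord => [|i].
  have e0 k : 0 <= enorm (y - x) ^+ k / k`!%:R by rewrite divr_ge0// exprn_ge0// enorm_ge0.
  by rewrite addr_ge0// mulr_ge0// enorm_ge0.
have dT j : is_diff y (coord_fun (taylor p.+1 F x) j) (fun v =>
    \sum_(k < p.+1) (k`!%:R)^-1 * iter_diff (coord_fun F j) (v :: nseq k (y - x)) x).
  rewrite (_ : coord_fun _ _ = fun y => \sum_(k < p.+2) (k`!%:R)^-1
    * iter_diff (coord_fun F j) (nseq k (y - x)) x); first exact: is_diff_taylor_coord.
  by apply/funext => z; exact: taylor_coordE.
have coordE (a b c d : 'rV[R]_m) (s t : R) : b ord0 i = s -> d ord0 i = t ->
    (a + b - (c + d)) ord0 i = (a ord0 i - c ord0 i) + (s - t).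
  by move=> <- <-; rewrite !mxE; ring.
have JF := @jacobian_coord R n m F y v i (fun j => (dF j).1 y).
have JT := @jacobian_coord R n m (taylor p.+1 F x) y v i (fun j => @ex_diff _ _ _ _ _ _ _ (dT j)).
have dTE := congr1 (@^~ v) (@diff_val _ _ _ _ _ _ _ (dT i)).
rewrite (coordE _ _ _ _ _ _ JF (etrans JT dTE)).
rewrite mulrDl.
apply: le_trans (ler_normD _ _) _; apply: lerD.
  by rewrite taylor_coordE; exact: taylor_remainder_coord.
exact: taylor_diff_remainder_coord.
Qed.

(** * Lipschitz continuity of [g] *)

Lemma enorm0 (R : realType) (n : nat) : enorm (0 : 'rV[R]_n) = 0.
Proof. by rewrite -(scale0r (0 : 'rV[R]_n)) enormZ normr0 mul0r. Qed.

Lemma elipschitz_const_ge0 (R : realType) (m : nat) (Lg : R) (g : 'rV[R]_m -> R)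
    (u : 'rV[R]_m) :
  elipschitz Lg g -> 0 <= Lg * enorm u.
Proof. by move=> /(_ u 0); rewrite subr0; apply: le_trans. Qed.

(* [Lg] may be negative, but only if all vectors have norm [0], i.e. [m = 0]. *)
Lemma elipschitz_bound (R : realType) (m : nat) (Lg c : R) (g : 'rV[R]_m -> R)
    (a b u : 'rV[R]_m) :
  elipschitz Lg g -> enorm (a - b) <= c * enorm u ->
  `|g a - g b| <= c * (Lg * enorm u).
Proof.
move=> gL abu; apply: le_trans (gL a b) _.
have [Lg0|Lg0] := leP 0 Lg; first by rewrite mulrCA ler_wpM2l.
have norm0 (w : 'rV[R]_m) : enorm w = 0.
  apply/eqP; rewrite eq_le enorm_ge0 andbT.
  by have := elipschitz_const_ge0 w gL; rewrite nmulr_rge0.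
by rewrite !norm0 !mulr0.
Qed.

(** * Descent and criticality for the composite objective *)

Section Composite.
Context (R : realType) (n m p : nat) (hp : (1 <= p)%N).
Context (F : 'rV[R]_n -> 'rV[R]_m) (g : 'rV[R]_m -> R) (h : 'rV[R]_n -> \bar R).
Context (Lp : 'rV[R]_m) (Lg fstar : R).
Hypothesis hA : assumptionA p F g h Lp Lg fstar.
Let L := Lg * enorm Lp.

Lemma taylor_refl x : taylor p F x x = F x.
Proof.
have := enorm_taylor_remainder x x (F_differentiable hA) (F_lipschitz hA).
rewrite subrr enorm0 expr0n /= !mul0r => le0.
apply/esym/eqP; rewrite -subr_eq0; apply/eqP/enorm_eq0/eqP.
by rewrite eq_le le0 enorm_ge0.
Qed.

Lemma h_fin x : edom (objective F g h) x -> h x = (fine (h x))%:E.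
Proof.
rewrite /edom /objective /= => fx; rewrite fineK// fin_numE.
by have := (h_proper hA).1 x; case: (h x) fx.
Qed.

Lemma objective_fin x : edom (objective F g h) x ->
  objective F g h x = (g (F x) + fine (h x))%:E.
Proof. by move=> fx; rewrite /objective (h_fin fx). Qed.

Lemma fstar_le x : edom (objective F g h) x -> fstar <= g (F x) + fine (h x).
Proof.
move=> fx; rewrite -lee_fin -objective_fin//.
by apply: le_trans (fstar_le_inf hA) _; apply: ereal_inf_lbound; exists x.
Qed.

(** By [taylor_refl] the model at [x] equals the objective. At [x'], replacing [T] by [F] inside [g]
    costs at most [L * ||x' - x||^(p+1) / (p+1)!], which is subtracted from the regularization
    term. *)
Lemma descent (M : R) x x' :
  edom (objective F g h) x -> edom (objective F g h) x' ->
  (model p M F g h x x' <= model p M F g h x x)%E ->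
  (M - L) / p.+1`!%:R * enorm (x' - x) ^+ p.+1
  <= (g (F x) + fine (h x)) - (g (F x') + fine (h x')).
Proof.
move=> fx fx'.
rewrite /model taylor_refl subrr enorm0 (h_fin fx) (h_fin fx') -!EFinD lee_fin.
rewrite expr0n /= mulr0 addr0.
have := elipschitz_bound (g_lipschitz hA)
  (enorm_taylor_remainder x x' (F_differentiable hA) (F_lipschitz hA)).
rewrite -/L ler_norml => /andP[_].
rewrite [enorm _ ^+ _ / _]mulrC -mulrA mulrA [M * _]mulrC.
set i := _^-1; set e := _ ^+ _ => h1 h2; rewrite -subr_ge0.
have -> : (M - L) * i * e = i * M * e - i * (e * L) by ring.
lra.
Qed.

(** The ball of radius [rmin] lies in that of radius [r], and on it the two functions being
    minimized differ by the linearization error and the gradient of the regularization. The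
    remainder of the value counts twice: in the linearization and in [f(x')] itself. *)
Lemma criticality_bound (M r rmin c : R) x x' :
  0 <= M -> edom (objective F g h) x' -> rmin <= r -> 0 <= r ->
  (model_criticality p M F g h r x x' <= c%:E)%E ->
  (criticality F g h rmin x' <= (c + 2 * (enorm (x' - x) ^+ p.+1 / p.+1`!%:R * L)
     + enorm (x' - x) ^+ p / p`!%:R * r * (L + M))%:E)%E.
Proof.
move=> M0 fx' rminr r0.
rewrite /model_criticality /criticality (objective_fin fx').
set I := ereal_inf _; set J := ereal_inf _; set d := enorm (x' - x).
set T := taylor p F x.
rewrite (h_fin fx') -EFinD; set H := fine _.
have d0 k : 0 <= d ^+ k / k`!%:R by rewrite divr_ge0// exprn_ge0// enorm_ge0.
have L0 : 0 <= L := elipschitz_const_ge0 Lp (g_lipschitz hA).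
have value_err := elipschitz_bound (g_lipschitz hA)
  (enorm_taylor_remainder x x' (F_differentiable hA) (F_lipschitz hA)).
rewrite -/L -/T -/d in value_err.
move=> Ic.
(* A real lower bound on [I] replaces the difference of extended reals and passes to [J] point by
   point. *)
have {Ic} aI : ((g (T x') + H - c)%:E <= I)%E.
  move: Ic; case: I => [s| |] //=; last by rewrite leey.
  by rewrite -EFinB !lee_fin lerBlDr lerBlDl addrC.
pose err := d ^+ p.+1 / p.+1`!%:R * L + d ^+ p / p`!%:R * r * (L + M).
have step (y : 'rV[R]_n) (a G1 G2 D : R) : enorm (y - x') <= rmin ->
    `|G1 - G2| <= (d ^+ p.+1 / p.+1`!%:R + d ^+ p / p`!%:R * enorm (y - x')) * L ->
    `|D| <= d * enorm (y - x') ->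
    (a%:E <= (G2 + M / p`!%:R * d ^+ p.-1 * D)%:E + h y)%E ->
    ((a - err)%:E <= G1%:E + h y)%E.
  move=> /le_trans/(_ rminr) yr lin_err cs.
  have h1 : G2 - G1 <= d ^+ p.+1 / p.+1`!%:R * L + d ^+ p / p`!%:R * r * L.
    move: lin_err; rewrite ler_norml => /andP[+ _].
    rewrite lerNl opprB => /le_trans; apply; rewrite mulrDl lerD2l.
    by rewrite ler_wpM2r// ler_wpM2l.
  (* Here [1 <= p] is used: [d^(p-1)] from the gradient and [d] from Cauchy-Schwarz combine into
     [d^p]. *)
  have h2 : M / p`!%:R * d ^+ p.-1 * D <= d ^+ p / p`!%:R * r * M.
    have -> : d ^+ p / p`!%:R * r * M = M / p`!%:R * d ^+ p.-1 * (d * r).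
      by rewrite -[in LHS](prednK hp) exprS [p.-1.+1]prednK//; ring.
    apply: ler_wpM2l; first by rewrite mulr_ge0 ?divr_ge0// exprn_ge0// enorm_ge0.
    apply: le_trans (ler_norm _) _; apply: le_trans cs _.
    by rewrite ler_wpM2l// enorm_ge0.
  have := (h_proper hA).1 y.
  case: (h y) => [s| |] //= _; last by rewrite !addey// !leey.
  by rewrite -!EFinD !lee_fin /err; lra.
have {aI} aJ : ((g (T x') + H - c - err)%:E <= J)%E.
  apply: le_ereal_inf_tmp => _ [y yr <-]; rewrite /eclosed_ball /= in yr.
  have yr' := le_trans yr rminr.
  have aIy := le_trans aI (ereal_inf_lbound (ex_intro2 _ _ y yr' erefl)).
  apply: step yr _ _ aIy; last exact: dotp_cauchy_schwarz.
  exact: (elipschitz_bound (g_lipschitz hA) (enorm_taylor_linearization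
    x x' (y - x') hp (F_differentiable hA) (F_lipschitz hA))).
move: value_err; rewrite ler_norml => /andP[_ value_err].
case: J aJ => [s| |] //= aJ; last by rewrite leNye.
rewrite lee_fin in aJ; rewrite -EFinB lee_fin; rewrite /err in aJ.
lra.
Qed.

End Composite.

(** * Real powers and averages *)

Lemma ler_powR_root (R : realType) (q : nat) (d B : R) :
  0 <= d -> d ^+ q.+1 <= B -> d <= B `^ (q.+1%:R^-1).
Proof.
move=> d0 dB; have B0 : 0 <= B := le_trans (exprn_ge0 _ d0) dB.
have -> : d = (d ^+ q.+1) `^ (q.+1%:R^-1).
  by rewrite -powR_mulrn// -powRrM divff ?pnatr_eq0// powRr1.
by apply: ge0_ler_powR; rewrite ?nnegrE ?invr_ge0 ?exprn_ge0.
Qed.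

Lemma ler_expn_powR (R : realType) (p q : nat) (d B : R) :
  0 <= d -> d ^+ q.+1 <= B -> d ^+ p <= B `^ (p%:R / q.+1%:R).
Proof.
move=> d0 dB; rewrite -powR_mulrn// mulrC powRrM.
apply: ge0_ler_powR; rewrite ?nnegrE ?powR_ge0 ?ler0n//.
exact: ler_powR_root.
Qed.

Lemma powR_div (R : realType) (a b e : R) : 0 <= a -> 0 < b ->
  (a / b) `^ e = a `^ e / b `^ e.
Proof.
move=> a0 b0; have be : b `^ e != 0 by rewrite gt_eqF// powR_gt0.
apply: (mulIf be); rewrite divfK// -powRM ?divr_ge0 ?(ltW b0)//.
by rewrite divfK// gt_eqF.
Qed.

Lemma exists_le_average (R : realFieldType) (k : nat) (a : nat -> R) :
  exists j : 'I_k.+1, a j * k.+1%:R <= \sum_(i < k.+1) a i.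
Proof.
have [j _ jP] := @arg_minP _ R 'I_k.+1 ord0 xpredT (fun i => a i) isT.
exists j; rewrite mulr_natr -[X in _ *+ X]card_ord -sumr_const.
by apply: ler_sum => i _; exact: jP.
Qed.

(** * The convergence rate *)

Theorem theorem4p7 (R : realType) (n m p : nat) (hp : (1 <= p)%N)
    (F : 'rV[R]_n -> 'rV[R]_m) (g : 'rV[R]_m -> R) (h : 'rV[R]_n -> \bar R)
    (Lp : 'rV[R]_m) (Lg fstar : R)
    (hA : assumptionA p F g h Lp Lg fstar)
    (M : R) (hM : 0 < M) (hML : 0 < M - Lg * enorm Lp)
    (x : nat -> 'rV[R]_n) (hx : RHOTA p M F g h x)
    (r : nat -> R) (rmin rmax : R)
    (hrmin : 0 < rmin) (hr : forall k, rmin <= r k <= rmax)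
    (delta : nat -> R) (deltamax : R)
    (hdelta : forall k, 0 <= delta k <= deltamax)
    (hcrit : forall k,
      (model_criticality p M F g h (r k) (x k) (x k.+1)
       <= (delta k / (p.+1)`!%:R * enorm (x k.+1 - x k) ^+ p)%:E)%E) :
  let gap : R := fine (objective F g h (x 0%N)) - fstar in
  let Cbar : R := (p.+1)`!%:R * gap / (M - Lg * enorm Lp) in
  let Dbar : R :=
    ((2 * Cbar `^ (p.+1%:R^-1) + p.+1%:R * rmax) * (Lg * enorm Lp)
     + p.+1%:R * M * rmax + p.+1%:R * deltamax) / (p.+1)`!%:R in
  let e : R := p%:R / p.+1%:R in
  forall k : nat,
    (\big[Order.min/+oo]_(j < k.+1) criticality F g h rmin (x j.+1)
     <= (Dbar * (gap * (p.+1)`!%:R) `^ e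
         / ((M - Lg * enorm Lp) `^ e * k.+1%:R `^ e))%:E)%E.
Proof.
move=> gap Cbar Dbar e k.
have [x0dom hstep] := hx.
have xdom j : edom (objective F g h) (x j) by case: j => [//|j]; have [] := hstep j.
pose L := Lg * enorm Lp; pose phi j := g (F (x j)) + fine (h (x j)).
pose d j := enorm (x j.+1 - x j).
have d0 j : 0 <= d j := enorm_ge0 _.
have L0 : 0 <= L := elipschitz_const_ge0 Lp (g_lipschitz hA).
have f0 : (0 : R) < p.+1`!%:R by rewrite ltr0n fact_gt0.
have gapE : gap = phi 0%N - fstar by rewrite /gap (objective_fin hA).
have gap0 : 0 <= gap by rewrite gapE subr_ge0 (fstar_le hA).
have desc j : (M - L) / p.+1`!%:R * d j ^+ p.+1 <= phi j - phi j.+1.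
  exact: (descent hA (xdom j) (xdom j.+1) (hstep j).2).
(* The decreases telescope, and [fstar] bounds the last value from below, so the bound is uniform in
   [l]. *)
have sum_le l : \sum_(j < l) d j ^+ p.+1 <= Cbar.
  have : \sum_(j < l) (M - L) / p.+1`!%:R * d j ^+ p.+1 <= gap.
    apply: (@le_trans _ _ (phi 0%N - phi l)); last first.
      by rewrite gapE lerD2l lerN2 (fstar_le hA).
    elim: l => [|l IHl]; first by rewrite big_ord0 subrr.
    rewrite big_ord_recr /=; have := desc l; lra.
  rewrite -mulr_sumr mulrAC ler_pdivrMr// mulrC -ler_pdivlMr//.
  by rewrite /Cbar [gap * _]mulrC.
(* This crude bound on one step absorbs the extra factor of [d^(p+1) = d * d^p], which explains the
   power of [Cbar] in [Dbar]. *)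
have dC j : d j <= Cbar `^ (p.+1%:R^-1).
  apply: ler_powR_root => //; apply: le_trans (sum_le j.+1).
  by rewrite big_ord_recr /= lerDr sumr_ge0// => i _; rewrite exprn_ge0.
have [j jP] := exists_le_average k (fun j => d j ^+ p.+1).
apply: (@bigmin_inf _ _ _ _ j) => //.
have /andP[rj0 rj1] := hr j; have /andP[dj0 dj1] := hdelta j.
have rjpos : 0 <= r j by rewrite (le_trans (ltW hrmin)).
apply: le_trans (criticality_bound hp hA (ltW hM) (xdom j.+1) rj0 rjpos (hcrit j)) _.
rewrite lee_fin -/(d j) -/L.
have rate : d j ^+ p <= (gap * p.+1`!%:R) `^ e / ((M - L) `^ e * k.+1%:R `^ e).
  rewrite -powRM ?(ltW hML)// -powR_div ?mulr_ge0 ?mulr_gt0//.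
  apply: ler_expn_powR => //.
  rewrite invfM mulrA ler_pdivlMr// [gap * _]mulrC.
  exact: le_trans jP (sum_le _).
have rmax0 : 0 <= rmax := le_trans rjpos rj1.
have deltamax0 : 0 <= deltamax := le_trans dj0 dj1.
have Dbar0 : 0 <= Dbar.
  have M0 := ltW hM; have C0 := powR_ge0 Cbar p.+1%:R^-1.
  by rewrite /Dbar divr_ge0// !addr_ge0// mulr_ge0// ?addr_ge0// mulr_ge0.
apply: (@le_trans _ _ (Dbar * d j ^+ p)); last first.
  by rewrite -/L -mulrA ler_wpM2l.
(* Factoring out [d^p / (p+1)!] turns each [1/p!] into a factor [p + 1], as in [Dbar]. *)
have -> : delta j / p.+1`!%:R * d j ^+ p
      + 2 * (d j ^+ p.+1 / p.+1`!%:R * L) + d j ^+ p / p`!%:R * r j * (L + M) =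
    (2 * d j * L + p.+1%:R * r j * L + p.+1%:R * M * r j + delta j) / p.+1`!%:R
      * d j ^+ p.
  have p0 : (p`!%:R : R) != 0 by rewrite pnatr_eq0 -lt0n fact_gt0.
  have p1 : (p.+1%:R : R) != 0 by rewrite pnatr_eq0.
  rewrite exprS factS natrM; field.
  by rewrite p0 addrC natr1 p1.
rewrite ler_wpM2r ?exprn_ge0// /Dbar ler_pM2r ?invr_gt0//.
have p1 : (1 : R) <= p.+1%:R by rewrite ler1n.
have h1 : 2 * d j * L <= 2 * Cbar `^ (p.+1%:R^-1) * L.
  by rewrite ler_wpM2r// ler_wpM2l.
have h2 : p.+1%:R * r j * L <= p.+1%:R * rmax * L by rewrite ler_wpM2r// ler_wpM2l.
have h3 : p.+1%:R * M * r j <= p.+1%:R * M * rmax.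
  by rewrite ler_wpM2l// mulr_ge0// ltW.
(* As [1 <= p + 1] and [deltamax >= 0], the error fits under the last term of [Dbar]. *)
have h4 : delta j <= p.+1%:R * deltamax by rewrite (le_trans dj1)// ler_peMl.
rewrite -/L mulrDl; lra.
Qed.
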